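(* Let $S$ be a $k$-stellated sphere of dimension $d\ge 2k-1$. Then any sequence of bistellar moves of index $<k$ used to obtain $S$ from $S^{d}_{d+2}$ contains exactly $g_{j+1}(S)$ moves of index $j$ ($0\le j<k$). Hence the length of $S$ is given by the formula $l(S)=h_k(S)-1$.
   Context: All simplicial complexes are finite and abstract, with the empty set as a face. For a finite set $\alpha$, $\overline{\alpha}$ is the complex of all subsets of $\alpha$ and $\partial\alpha$ the complex of all proper subsets. The join $X\ast Y$ (disjoint vertex sets) has as faces the disjoint unions of a face of $X$ and a face of $Y$. The standard sphere $S^d_{d+2}$ is $\partial\alpha$ with $\#\alpha=d+2$. Complexes are identified up to isomorphism. Bistellar moves: if $X$ is $d$-dimensional and $\alpha,\beta$ are disjoint nonempty sets with $\dim\alpha+\dim\beta=d$ (where $\dim\alpha=\#\alpha-1$) such that the set of faces of $X$ contained in $\alpha\sqcup\beta$ is exactly $\overline{\alpha}\ast\partial\beta$, then $Y=(X\setminus(\overline\alpha\ast\partial\beta))\cup(\partial\alpha\ast\overline\beta)$ is obtained from $X$ by the bistellar move $\alpha\mapsto\beta$, of index $\dim\beta$ (if $\beta$ is a single vertex, it is a new vertex). For $0\le k\le d+1$, a $d$-dimensional complex is $k$-stellated if it is obtained from $S^d_{d+2}$ by a finite sequence of bistellar moves, each of index $<k$ ($S^d_{d+2}$ is the only $0$-stellated one). The length $l(S)$ of a $k$-stellated $S$ is the smallest number $n$ of moves in such a sequence. For $X$ of dimension $d$, $f_i(X)$ is the number of $i$-dimensional faces ($f_{-1}=1$); $h_j(X)=\sum_{i=-1}^{j-1}(-1)^{j-i-1}\binom{d-i}{j-i-1}f_i(X)$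 for $0\le j\le d+1$, with $h_0=1$ and the convention $h_{-1}=0$; and $g_j(X)=h_j(X)-h_{j-1}(X)$ for $0\le j\le d+1$. *)

(* Defs.v *)
From mathcomp Require Import all_boot all_order all_algebra finmap.
From mathcomp Require Import boolp.

Set Implicit Arguments.
Unset Strict Implicit.
Unset Printing Implicit Defensive.

Import Order.TTheory GRing.Theory Num.Theory.

Local Open Scope fset_scope.
Local Open Scope ring_scope.

(* Finite abstract complexes have their vertices in the fixed infinite set
   [nat]; every finite complex is isomorphic to one of this kind, and an
   infinite set always leaves a fresh label for a new vertex. *)
Notation simplex := {fset nat}.
Notation faces := {fset {fset nat}}.

Definition simplicial_complex (X : faces) : Prop :=
  fset0 \in X /\
  (forall s t : simplex, s \in X -> t `<=` s -> t \in X).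

Definition isomorphic (X Y : faces) : Prop :=
  exists f : nat -> nat,
    {in [pred v : nat | [fset v] \in X] &, injective f} /\
    Y = [fset [fset f v | v in s] | s : simplex in X].

Definition sdim (s : simplex) : int := (#|` s|)%:Z - 1.

(* One more than the dimension of a complex, so that it is a natural number
   even for the complex {emptyset}, which has dimension -1. *)
Definition max_face_card (X : faces) : nat := (\max_(s <- X) #|` s|)%N.

Definition dim (X : faces) : int := (max_face_card X)%:Z - 1.

Definition closed_simplex (a : simplex) : faces := fpowerset a.

Definition boundary (a : simplex) : faces := fpowerset a `\ a.

Definition join (X Y : faces) : faces :=
  [fset s `|` t | s in X, t in Y].

Record admissible (d : int) (X : faces) (a b : simplex) : Prop := Admissible {
  adm_complex : simplicial_complex X;
  adm_dim : dim X = d;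
  adm_source_neq0 : a != fset0;
  adm_target_neq0 : b != fset0;
  adm_disjoint : [disjoint a & b];
  adm_sdim : sdim a + sdim b = d;
  (* When b = [fset v], this forces v not to be a vertex of X. *)
  adm_induced :
    [fset s in X | s `<=` a `|` b] = join (closed_simplex a) (boundary b)
}.

Definition bistellar (X : faces) (a b : simplex) : faces :=
  (X `\` join (closed_simplex a) (boundary b))
    `|` join (boundary a) (closed_simplex b).

(* A move (a, b) stands for the bistellar move a |-> b; b is nonempty in every
   admissible move, so the truncated predecessor is the dimension of b. *)
Definition move_index (m : simplex * simplex) : nat := #|` m.2|.-1.

(* [stellation k d ms S]: ms is a sequence of moves of index < k leading from
   the standard d-sphere to S. As complexes are identified up to isomorphism,
   relabelling the vertices is allowed at the start and after each move. *)
Inductive stellation (k : nat) (d : int) :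
    seq (simplex * simplex) -> faces -> Prop :=
| stellation_sphere (a : simplex) (X : faces) :
    (#|` a|)%:Z = d + 2 ->
    isomorphic (boundary a) X ->
    stellation k d [::] X
| stellation_move (ms : seq (simplex * simplex)) (X Y : faces)
    (a b : simplex) :
    stellation k d ms X ->
    admissible d X a b ->
    (move_index (a, b) < k)%N ->
    isomorphic (bistellar X a b) Y ->
    stellation k d (rcons ms (a, b)) Y.

Definition stellated (k : nat) (d : int) (S : faces) : Prop :=
  [/\ k%:Z <= d + 1, simplicial_complex S, dim S = d
    & exists ms : seq (simplex * simplex), stellation k d ms S].

Definition stellated_in (k : nat) (d : int) (S : faces) : pred nat :=
  fun n => `[< exists2 ms, stellation k d ms S & size ms = n >].

Lemma stellated_in_some (k : nat) (d : int) (S : faces) :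
  stellated k d S -> exists n, stellated_in k d S n.
Proof.
by case=> _ _ _ [ms hms]; exists (size ms); apply/asboolP; exists ms.
Qed.

Definition stellated_length (k : nat) (d : int) (S : faces)
    (hS : stellated k d S) : nat :=
  ex_minn (stellated_in_some hS).

Definition face_number (X : faces) (i : int) : nat :=
  #|` [fset s in X | sdim s == i]|.

(* The usual sum over -1 <= i <= j - 1, reindexed by c = i + 1; for X of
   dimension d, max_face_card X - c = d - i. *)
Definition h_number (X : faces) (j : nat) : int :=
  \sum_(c < j.+1) (-1) ^+ (j - c) * ('C(max_face_card X - c, j - c))%:Z
                  * (face_number X (c%:Z - 1))%:Z.

(* The convention h_(-1) = 0 gives g_0 = h_0. *)
Definition g_number (X : faces) (j : nat) : int :=
  if j is i.+1 then h_number X i.+1 - h_number X i else h_number X 0.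

(* Main.v *)
Require Import Defs.
From mathcomp Require Import all_boot all_order all_algebra finmap.
From mathcomp Require Import boolp.
From mathcomp Require Import zify ring.

Set Implicit Arguments.
Unset Strict Implicit.
Unset Printing Implicit Defensive.

Import Order.TTheory GRing.Theory Num.Theory.

Local Open Scope fset_scope.
Local Open Scope ring_scope.

(* The polynomial sum over faces s of x^|s| (1 - x)^(n - |s|) has the h-numbers
   as coefficients for n = d + 1 and the g-numbers for n = d + 2.  In the
   latter normalisation it is multiplicative under joins, equals 1 on a full
   simplex with n vertices, hence 1 - x^(d+2) on the standard sphere, and a
   move a |-> b adds x^|b| - x^|a|.  When all indices are < k and
   2k <= d + 1, |b| <= k < |a|, so up to degree k the coefficients count
   the moves by index. *)

Definition face_poly (n : nat) (X : {fset {fset nat}}) : {poly int} :=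
  \sum_(s <- X) 'X^(#|` s|) * (1 - 'X) ^+ (n - #|` s|).

(** * Coefficients of the face polynomial and h-numbers *)

Lemma coef_face_term (n c j : nat) :
  ('X^c * (1 - 'X) ^+ (n - c) : {poly int})`_j =
  if (c <= j)%N then (-1) ^+ (j - c) * ('C(n - c, j - c))%:Z else 0.
Proof.
rewrite coefXnM ltnNge; case: (c <= j)%N => //=.
(* What remains is the coefficient of x^i in (1 - x)^m, by induction on m with Pascal's rule. *)
move: (n - c)%N (j - c)%N => m i {n c j}.
elim: m i => [|m IH] i.
  by rewrite expr0 coef1 bin0n; case: i => [|i]; rewrite ?mulr1 ?mulr0.
rewrite exprS mulrBl mul1r coefB coefXM IH.
case: i => [|i] /=; first by rewrite !bin0 subr0.
by rewrite IH binS PoszD exprS; ring.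
Qed.

(** The bound keeps the truncated subtraction exact, so each term gains one factor 1 - x. This
    passes from h-numbers to g-numbers. *)
Lemma face_polyS (n : nat) (X : {fset {fset nat}}) :
  {in X, forall s : {fset nat}, (#|` s| <= n)%N} ->
  face_poly n.+1 X = (1 - 'X) * face_poly n X.
Proof.
move=> le_n; rewrite /face_poly mulr_sumr !big_seq; apply: eq_bigr => s sX.
by rewrite subSn ?le_n // exprS mulrCA.
Qed.

Lemma leq_max_face_card (X : {fset {fset nat}}) :
  {in X, forall s : {fset nat}, (#|` s| <= max_face_card X)%N}.
Proof. by move=> s sX; apply: (leq_bigmax_seq s). Qed.

Lemma face_number_sum (X : {fset {fset nat}}) (c : nat) :
  (face_number X (c%:Z - 1))%:Z =
  \sum_(s <- X | #|` s : {fset nat}| == c) 1.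
Proof.
rewrite /face_number card_fset_sum1 -natz natr_sum big_fset /=.
by apply: eq_bigl => s; rewrite /sdim (inj_eq (addIr _)) eqz_nat.
Qed.

Lemma coef_face_poly (X : {fset {fset nat}}) (j : nat) :
  (face_poly (max_face_card X) X)`_j = h_number X j.
Proof.
rewrite /face_poly coef_sum /h_number; set n := max_face_card X.
under [RHS]eq_bigr => c _ do
  rewrite face_number_sum mulr_sumr big_mkcond mulr1.
rewrite exchange_big /=; apply: eq_bigr => s _; rewrite coef_face_term.
rewrite -big_mkcond /=; under [RHS]eq_bigl => c do rewrite eq_sym.
(* A face s contributes only at c = |s|, and only if |s| <= j: the case distinction of
   [coef_face_term]. *)
pose w c : int := (-1) ^+ (j - c) * ('C(n - c, j - c))%:Z.
by rewrite (big_ord1_eq +%R w) ltnS.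
Qed.

(** * Unions, joins and simplices *)

Lemma face_polyU (n : nat) (X Y : {fset {fset nat}}) : [disjoint X & Y] ->
  face_poly n (X `|` Y) = face_poly n X + face_poly n Y.
Proof.
move=> dXY; rewrite /face_poly (big_fsetID _ (mem X)) /=.
congr (_ + _); apply: eq_fbigl => s; rewrite !inE /=.
  by case: (s \in X); rewrite ?andbF.
by rewrite andb_orl andbN /= andb_idr // => /(fdisjointP_sym dXY).
Qed.

Lemma face_polyD (n : nat) (X Y : {fset {fset nat}}) : Y `<=` X ->
  face_poly n (X `\` Y) = face_poly n X - face_poly n Y.
Proof.
move=> sYX; have {2}-> : X = Y `|` (X `\` Y).
  by rewrite fsetUDl fsetDv fsetD0; apply/esym/fsetUidPr.
rewrite face_polyU.
  by rewrite addrAC subrr add0r.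
by apply/fdisjointP => s sY; rewrite inE sY.
Qed.

(** Intersecting with a and with b recovers the two parts of a face of the join, so faces correspond
    to pairs and both exponents add. *)
Lemma face_poly_join (a b : {fset nat}) (X Y : {fset {fset nat}}) :
  [disjoint a & b] -> X `<=` fpowerset a -> Y `<=` fpowerset b ->
  face_poly (#|` a| + #|` b|) (join X Y) =
  face_poly #|` a| X * face_poly #|` b| Y.
Proof.
move=> dab /fsubsetP sX /fsubsetP sY.
have restr (s t : {fset nat}) : s `<=` a -> t `<=` b ->
    (s `|` t) `&` a = s /\ (s `|` t) `&` b = t.
  move=> sa tb; rewrite !fsetIUl (fsetIidPl sa) (fsetIidPl tb).
  have /eqP-> : t `&` a == fset0.
    by rewrite fsetI_eq0 fdisjoint_sym (fdisjointWr tb).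
  have /eqP-> : s `&` b == fset0 by rewrite fsetI_eq0 (fdisjointWl sa).
  by rewrite fsetU0 fset0U.
rewrite /face_poly /join big_imfset2 /=; last first.
  move=> [s t] [s' t'] /andP[/= /sX + /sY +] /andP[/= /sX + /sY +] eq_st.
  rewrite !fpowersetE => sa tb sa' tb'.
  have := restr _ _ sa' tb'; rewrite -eq_st.
  by have [-> ->] := restr _ _ sa tb => -[-> ->].
rewrite mulr_suml !big_seq; apply: eq_bigr => s /sX; rewrite fpowersetE => sa.
rewrite mulr_sumr !big_seq; apply: eq_bigr => t /sY; rewrite fpowersetE => tb.
have dst : s `&` t = fset0.
  by apply/eqP; rewrite fsetI_eq0 (fdisjointWl sa) ?(fdisjointWr tb).
rewrite cardfsU dst cardfs0 subn0 mulrACA -!exprD.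
move: (fsubset_leq_card sa) (fsubset_leq_card tb).
by move: #|` a| #|` b| #|` s| #|` t| => p q i j ip jq; congr (_ * _ ^+ _); lia.
Qed.

(** Induction on the vertices: a simplex is the join of one vertex with the rest, and a single
    vertex gives (1 - x) + x = 1. *)
Lemma face_poly_closed_simplex (a : {fset nat}) :
  face_poly #|` a| (closed_simplex a) = 1.
Proof.
rewrite /closed_simplex; elim/fset1U_rect: a => [|v a va IH].
  by rewrite fpowerset0 /face_poly big_seq_fset1 cardfs0 !expr0 mulr1.
have -> : fpowerset (v |` a) = join (fpowerset [fset v]) (fpowerset a).
  apply/fsetP => s; rewrite fpowersetE; apply/idP/imfset2P => [sva|].
    exists (s `&` [fset v]) => /=; first by rewrite fpowersetE fsubsetIr.
    exists (s `&` a) => /=; first by rewrite fpowersetE fsubsetIr.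
    by rewrite -fsetIUr; apply/esym/fsetIidPl.
  move=> [t + [u + ->]] /=; rewrite !fpowersetE; exact: fsetUSS.
have -> : #|` v |` a| = (#|` [fset v]| + #|` a|)%N.
  by rewrite cardfsU1 va cardfs1.
rewrite face_poly_join ?fdisjoint1X // IH mulr1.
rewrite fpowerset1 cardfs1 /face_poly big_fsetU1 ?big_seq_fset1 /=.
  by rewrite cardfs1 expr0 expr1 mul1r mulr1 subrK.
by rewrite inE eq_sym -cardfs_eq0 cardfs1.
Qed.

Lemma face_poly_boundary (a : {fset nat}) :
  face_poly #|` a| (boundary a) = 1 - 'X^(#|` a|).
Proof.
rewrite /boundary face_polyD ?fsub1set ?fpowersetE //.
rewrite -/(closed_simplex a) face_poly_closed_simplex.
by rewrite /face_poly big_seq_fset1 subnn mulr1.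
Qed.

(** * Effect of moves and isomorphisms *)

Lemma boundary_sub (a : {fset nat}) : boundary a `<=` fpowerset a.
Proof. exact: fsubD1set. Qed.

(** By multiplicativity the removed join contributes 1 - x^|b| and the inserted one 1 - x^|a|. *)
Lemma face_poly_bistellar (d : int) (X : {fset {fset nat}})
    (a b : {fset nat}) : admissible d X a b ->
  face_poly (#|` a| + #|` b|) (bistellar X a b) =
  face_poly (#|` a| + #|` b|) X + 'X^(#|` b|) - 'X^(#|` a|).
Proof.
move=> [_ _ _ _ dab _ ind]; rewrite /bistellar.
rewrite face_polyU; last first.
  (* An inserted face lies in the union of a and b; if it were already in X, [ind] would place it in
     the removed join. *)
  apply/fdisjointP => s; rewrite in_fsetD -ind !inE /= => /andP[+ sX].
  rewrite sX /=; apply: contra => /imfset2P[t + [u + ->]] /=.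
  rewrite !inE !fpowersetE => /andP[_ ta]; exact: fsetUSS.
rewrite face_polyD; last by rewrite -ind; apply: fset_sub.
rewrite !face_poly_join ?boundary_sub //.
rewrite !face_poly_closed_simplex !face_poly_boundary; ring.
Qed.

(* An isomorphism is only injective on the vertices v with [fset v] \in X, so
   the points of the faces must be known to be such vertices. *)
Lemma face_poly_isomorphic (n : nat) (X Y : {fset {fset nat}}) :
  (forall (s : {fset nat}) v, s \in X -> v \in s -> [fset v] \in X) ->
  isomorphic X Y -> face_poly n Y = face_poly n X.
Proof.
move=> vX [f [f_inj ->]]; rewrite /face_poly.
have f_injs : {in X, forall s : {fset nat}, {in s &, injective f}}.
  by move=> s sX u v us vs; apply: f_inj; rewrite inE; apply: vX sX _.
rewrite big_imfset /= => [|s t sX tX fst]; last first.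
  have sub (s' t' : {fset nat}) : s' \in X -> t' \in X ->
      [fset f v | v in s'] = [fset f v | v in t'] -> s' `<=` t'.
    move=> sX' tX' fst'; apply/fsubsetP => v vs.
    have /imfsetP[u /= ut fuv] : f v \in [fset f v | v in t'].
      by rewrite -fst' in_imfset.
    by rewrite (f_inj _ _ _ _ fuv) // inE; [exact: vX sX' _ | exact: vX tX' _].
  by apply/eqP; rewrite eqEfsubset !sub.
rewrite !big_seq; apply: eq_bigr => s sX.
by rewrite card_in_imfset //; apply: f_injs.
Qed.

(* If a is a single vertex, it disappears although faces through it may
   survive; hence the bound on a. *)
Lemma vertex_bistellar (d : int) (X : {fset {fset nat}})
    (a b s : {fset nat}) (v : nat) : admissible d X a b -> (1 < #|` a|)%N ->
  s \in bistellar X a b -> v \in s -> [fset v] \in bistellar X a b.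
Proof.
move=> [[_ subX] _ _ _ _ _ ind] a_gt1 sY vs.
have a_neq1 (w : nat) : [fset w] != a.
  by apply: contraTneq a_gt1 => <-; rewrite cardfs1.
(* A vertex of a spans a proper face since |a| > 1; a vertex of b is joined to the empty face. *)
have vab : v \in a `|` b -> [fset v] \in join (boundary a) (closed_simplex b).
  rewrite inE => /orP[va|vb]; apply/imfset2P.
    exists [fset v] => /=; first by rewrite !inE a_neq1 fpowersetE fsub1set.
    by exists fset0; rewrite /= ?fpowersetE ?fsub0set ?fsetU0.
  exists fset0 => /=.
    by rewrite !inE fpowersetE fsub0set eq_sym -cardfs_eq0 -lt0n ltnW.
  by exists [fset v]; rewrite /= ?fpowersetE ?fsub1set ?fset0U.
rewrite /bistellar in_fsetU in_fsetD -ind.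
move: sY; rewrite in_fsetU => /orP[|/imfset2P[t + [u + s_tu]]].
  (* A vertex of a surviving face is kept if outside a and b, and reinserted by [vab] otherwise. *)
  rewrite in_fsetD => /andP[_ sX].
  have vX : [fset v] \in X by apply: subX sX _; rewrite fsub1set.
  rewrite !inE vX /= andbT fsub1set.
  by case: (boolP (v \in _)) => //= /vab ->.
rewrite /= !inE !fpowersetE => /andP[_ ta] ub.
have {}vab := vab _; rewrite vab ?orbT //.
by apply: (fsubsetP (fsetUSS ta ub)); rewrite -s_tu.
Qed.

(** Supplies the vertex hypothesis of [face_poly_isomorphic] for the standard sphere. *)
Lemma vertex_boundary (a s : {fset nat}) (v : nat) :
  s \in boundary a -> v \in s -> [fset v] \in boundary a.
Proof.
rewrite !inE !fpowersetE => /andP[s_neq sa] vs.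
rewrite fsub1set (fsubsetP sa) // andbT; apply: contraNneq s_neq => va.
by rewrite eqEfsubset sa -va fsub1set.
Qed.

(** * Counting moves by index *)

Lemma stellation_face_poly (k n : nat) (ms : seq ({fset nat} * {fset nat}))
    (X : {fset {fset nat}}) :
  (2 * k <= n)%N -> stellation k (n%:Z - 1) ms X ->
  {in ms, forall m, 0 < #|` m.2| <= k /\ k < #|` m.1|}%N /\
  face_poly n.+1 X =
    1 - 'X^(n.+1) + \sum_(m <- ms) ('X^(#|` m.2|) - 'X^(#|` m.1|)).
Proof.
move=> k_le; elim=> [a {}X card_a iso|{}ms {}X Y a b _ [bnd IH] adm mi iso].
  split=> //; rewrite big_nil addr0 (face_poly_isomorphic _ _ iso).
    have <- : #|` a| = n.+1 by lia.
    exact: face_poly_boundary.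
  exact: vertex_boundary.
have b_gt0 : (0 < #|` b|)%N.
  by case: adm => _ _ _ b0 _ _ _; rewrite lt0n cardfs_eq0.
have card_ab : (#|` a| + #|` b|)%N = n.+1.
  by case: adm => _ _ _ _ _; rewrite /sdim; lia.
rewrite /move_index /= in mi.
have b_le : (#|` b| <= k)%N by rewrite -(prednK b_gt0).
(* From |a| + |b| = n + 1, |b| <= k and 2k <= n. *)
have a_gt : (k < #|` a|)%N.
  by move: card_ab b_le; move: #|` a| #|` b| => p q; lia.
split=> [m|].
  by rewrite mem_rcons inE => /orP[/eqP->|/bnd //]; rewrite b_gt0.
rewrite (face_poly_isomorphic _ _ iso).
  by rewrite -card_ab (face_poly_bistellar adm) card_ab IH big_rcons /=; ring.
move=> s v; apply: (vertex_bistellar adm).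
by apply: leq_trans a_gt; rewrite ltnS (leq_trans b_gt0).
Qed.

(** The factor 1 - x takes differences of consecutive coefficients; in degree 0 nothing is
    subtracted, matching h_(-1) = 0. *)
Lemma g_number_face_poly (X : {fset {fset nat}}) (j : nat) :
  g_number X j = (face_poly (max_face_card X).+1 X)`_j.
Proof.
rewrite face_polyS; last exact: leq_max_face_card.
rewrite mulrBl mul1r coefB coefXM !coef_face_poly /g_number.
by case: j => [|j]; rewrite ?subr0.
Qed.

Lemma h_number_sum_g (X : {fset {fset nat}}) (j : nat) :
  h_number X j = \sum_(i < j.+1) g_number X i.
Proof.
elim: j => [|j IH]; first by rewrite big_ord_recl big_ord0 addr0.
by rewrite big_ord_recr /= -IH addrC subrK.
Qed.

Theorem proposition4p3 (k : nat) (d : int) (S : {fset {fset nat}})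
    (hd : 2 * k%:Z - 1 <= d) (hS : stellated k d S) :
  (forall ms : seq ({fset nat} * {fset nat}), stellation k d ms S ->
     forall j : nat, (j < k)%N ->
       (count (fun m => move_index m == j) ms)%:Z = g_number S j.+1)
  /\ (stellated_length hS)%:Z = h_number S k - 1.
Proof.
have dim_S : d = (max_face_card S)%:Z - 1 by case: hS => _ _ <-.
have k_le : (2 * k <= max_face_card S)%N by lia.
have bnd ms (st : stellation k d ms S) :
    {in ms, forall m, 0 < #|` m.2| <= k /\ k < #|` m.1|}%N.
  by rewrite dim_S in st; case: (stellation_face_poly k_le st).
(* In degrees up to k the terms x^(d+2) and x^|a| vanish, as both exponents exceed k; the constant 1
   and the x^|b| remain. *)
have coef_g ms j : stellation k d ms S -> (j <= k)%N ->
    g_number S j =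
    (j == 0%N)%:R + (count (fun m => #|` m.2| == j) ms)%:Z.
  move=> st j_le; have bnd_ms := bnd _ st.
  rewrite dim_S in st; have [_ fS] := stellation_face_poly k_le st.
  rewrite g_number_face_poly fS coefD coefB coef1 coefXn.
  rewrite (_ : (j == _.+1) = false) ?subr0; last by lia.
  congr (_ + _); rewrite coef_sum -sum1_count -natz natr_sum [RHS]big_mkcond /=.
  apply: eq_big_seq => m /bnd_ms[_ m1].
  rewrite coefB !coefXn (ltn_eqF (leq_ltn_trans j_le m1)) subr0.
  by rewrite eq_sym; case: eqP.
have count_g ms j : stellation k d ms S -> (j < k)%N ->
    (count (fun m => move_index m == j) ms)%:Z = g_number S j.+1.
  move=> st j_lt; rewrite (coef_g ms) //= add0r; congr Posz.
  apply: eq_in_count => m /(bnd _ st)[/andP[m2 _] _].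
  by rewrite /move_index -eqSS prednK.
split; first by move=> ms st j; apply: count_g.
(* In the sum of g_0, ..., g_k, the first term is 1 and each move is counted exactly once, at index
   |b| - 1 < k. *)
have size_h ms : stellation k d ms S -> (size ms)%:Z = h_number S k - 1.
  move=> st; rewrite h_number_sum_g big_ord_recl (coef_g ms) //.
  have count0 : count (fun m : simplex * simplex => #|` m.2| == 0%N) ms = 0%N.
    rewrite -[RHS](count_pred0 ms); apply: eq_in_count.
    by move=> m /(bnd _ st)[/andP[/gtn_eqF]].
  rewrite count0 addr0 addrAC subrr add0r.
  under eq_bigr => j _ do
    rewrite lift0 -(count_g ms) // -natz -sum1_count natr_sum big_mkcond.
  rewrite exchange_big /= -sum1_size -natz natr_sum.
  apply: eq_big_seq => m /(bnd _ st)[/andP[m2 m2k] _]; rewrite -big_mkcond /=.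
  under eq_bigl => j do rewrite eq_sym.
  rewrite (big_ord1_eq +%R (fun=> 1)) ifT //.
  by rewrite /move_index prednK.
(* The minimal length is attained by some sequence, whose size is already known. *)
have [ms st <-] : exists2 ms, stellation k d ms S
    & size ms = stellated_length hS.
  apply/asboolP; rewrite /stellated_length.
  by case: (ex_minnP (stellated_in_some hS)).
exact: size_h.
Qed.
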